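(* Let $n\ge1$ and let $b_1,\dots,b_n$ be real numbers. There exists a pure Gaussian state $\rho=|\psi\rangle\langle\psi|$ of $n$ modes whose reduced states $\rho_k$ to the individual modes have symplectic eigenvalues $$\mathrm{sspec}(\rho_k)=b_k+1,\qquad k=1,\dots,n,$$ if and only if $b_j\ge 0$ and $$b_j\le\sum_{k\ne j}b_k$$ for all $j=1,\dots,n$.
   Context: For $n$ bosonic modes with canonical coordinates $R=(x_1,p_1,\dots,x_n,p_n)$, $[R_j,R_k]=i\sigma_{jk}$, $\sigma=\bigoplus_{k=1}^n\begin{pmatrix}0&1\\-1&0\end{pmatrix}$, a Gaussian state $\rho$ is a quantum state with Gaussian characteristic function; it is determined by its first moments $\mu_j=\mathrm{tr}(\rho R_j)$ and its real symmetric $2n\times 2n$ covariance matrix $\gamma_{jk}=\mathrm{tr}(\rho\{R_j-\mu_j,R_k-\mu_k\})$ (so the vacuum has $\gamma=\mathbb{1}$). The covariance matrices of Gaussian states are exactly the real symmetric matrices with $\gamma+i\sigma\ge 0$. The symplectic spectrum of a Gaussian state is that of its covariance matrix: the numbers $(d_1,\dots,d_n)$ such that $S\gamma S^T=\mathrm{diag}(d_1,d_1,\dots,d_n,d_n)$ for some real $S$ with $S\sigma S^T=\sigma$. A Gaussian state is pure if and only if all its symplectic eigenvalues equal $1$. The reduced state $\rho_k$ to the $k$-th mode is the Gaussian state whose covariance matrix is the $k$-th $2\times2$ main diagonal block $\gamma_k$ of $\gamma$ (rows and columns $2k-1,2k$), and $\mathrm{sspec}(\rho_k)=\sqrt{\det\gamma_k}$.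 Empty sums are $0$. *)

(* Defs.v *)
From mathcomp Require Import all_boot all_order all_algebra.
From mathcomp Require Import reals complex.

Set Implicit Arguments.
Unset Strict Implicit.
Unset Printing Implicit Defensive.

Import Order.TTheory GRing.Theory Num.Theory.
Local Open Scope ring_scope.
Local Open Scope sesquilinear_scope.
Local Open Scope complex_scope.

(* Phase-space dimension of n modes.  Writing 2n as a sum of n blocks of size 2
   lets the block operations of the matrix library (\mxdiag, submxblock) act
   mode by mode; flat indices follow the order (x_1, p_1, ..., x_n, p_n). *)
Notation phase_dim n := (\sum_(k < n) 2)%N.

Section PhaseSpace.
Variable R : realType.

(* The matrix (0 1; -1 0). *)
Definition sigma1 : 'M[R]_2 :=
  \matrix_(i < 2, j < 2) ((i < j)%N%:R - (j < i)%N%:R).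

Definition sigma (n : nat) : 'M[R]_(phase_dim n) := \mxdiag_(k < n) sigma1.

Definition symplectic (n : nat) (S : 'M[R]_(phase_dim n)) : Prop :=
  S *m sigma n *m S^T = sigma n.

(* For z : R[i], 0 <= z means that z is real and nonnegative; in particular a
   matrix satisfying psd is Hermitian. *)
Definition psd (m : nat) (A : 'M[R[i]]_m) : Prop :=
  forall v : 'cV[R[i]]_m, 0 <= (v ^t* *m A *m v) 0 0.

Definition cplx (m p : nat) (A : 'M[R]_(m, p)) : 'M[R[i]]_(m, p) :=
  map_mx (real_complex R) A.

Definition uncertainty (n : nat) (g : 'M[R]_(phase_dim n)) : Prop :=
  psd (cplx g + 'i *: cplx (sigma n)).

(* A Gaussian state is identified with its moments of order one and two: they
   determine it, and the uncertainty relation characterizes the covariance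
   matrices that occur.  Normalization: the vacuum has covariance 1. *)
Record gaussian_state (n : nat) := GaussianState {
  mean : 'cV[R]_(phase_dim n);
  cov : 'M[R]_(phase_dim n);
  cov_sym : cov^T = cov;
  cov_uncertainty : uncertainty cov }.

(* The numbers d_1, ..., d_n are determined by gamma only up to order. *)
Definition symplectic_spectrum (n : nat) (g : 'M[R]_(phase_dim n))
    (d : 'I_n -> R) : Prop :=
  exists S : 'M[R]_(phase_dim n),
    symplectic S /\ S *m g *m S^T = \mxdiag_(k < n) ((d k)%:M : 'M[R]_2).

Definition sspec (n : nat) (rho : gaussian_state n) (d : 'I_n -> R) : Prop :=
  symplectic_spectrum (cov rho) d.

(* A Gaussian state is a rank-one projector |psi><psi| exactly when all its
   symplectic eigenvalues are 1. *)
Definition pure (n : nat) (rho : gaussian_state n) : Prop :=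
  sspec rho (fun=> 1).

Definition reduced_cov (n : nat) (g : 'M[R]_(phase_dim n)) (k : 'I_n) :
    'M[R]_(phase_dim 1) := \mxblock_(i < 1, j < 1) submxblock g k k.

Definition reduced_mean (n : nat) (m : 'cV[R]_(phase_dim n)) (k : 'I_n) :
    'cV[R]_(phase_dim 1) := \mxcol_(i < 1) submxcol m k.

Lemma reduced_cov_sym n (g : 'M[R]_(phase_dim n)) k :
  g^T = g -> (reduced_cov g k)^T = reduced_cov g k.
Proof.
move=> gs; rewrite /reduced_cov tr_mxblock; apply: eq_mxblock => i j.
by rewrite tr_submxblock gs.
Qed.

Lemma reduced_sigma n (k : 'I_n) : reduced_cov (sigma n) k = sigma 1.
Proof.
apply/mxblockP => i j; rewrite mxblockK !ord1.
by rewrite /sigma !submxblock_diag.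
Qed.

Lemma psd_mxsub m p (f : 'I_p -> 'I_m) (A : 'M[R[i]]_m) :
  psd A -> psd (mxsub f f A).
Proof.
move=> Apsd v; pose F : 'M[R[i]]_(p, m) := rowsub f 1%:M.
have Ftr : F^T = colsub f 1%:M by apply/matrixP => i j; rewrite !mxE eq_sym.
have -> : mxsub f f A = F *m A *m F^T.
  rewrite Ftr mul_rowsub_mx mul1mx mulmx_colsub mulmx1.
  by apply/matrixP => i j; rewrite !mxE.
have FC : map_mx Num.conj F = F.
  by apply/matrixP => i j; rewrite !mxE conjC_nat.
have vF : (F^T *m v) ^t* = v ^t* *m F.
  by rewrite -[in RHS]FC -map_mxM -[F in RHS]trmxK -trmx_mul.
by have := Apsd (F^T *m v); rewrite vF !mulmxA.
Qed.

Lemma reduced_cov_uncertainty n (g : 'M[R]_(phase_dim n)) k :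
  uncertainty g -> uncertainty (reduced_cov g k).
Proof.
pose f (s : 'I_(phase_dim 1)) : 'I_(phase_dim n) :=
  @tagnat.Rank n (fun=> 2) k (tagnat.sig2 s).
have fE (h : 'M[R]_(phase_dim n)) : reduced_cov h k = mxsub f f h.
  by apply/matrixP => i j; rewrite !mxE.
rewrite /uncertainty -(reduced_sigma k) !fE => /(psd_mxsub f).
congr psd; by apply/matrixP => i j; rewrite !mxE.
Qed.

Definition reduced_state (n : nat) (rho : gaussian_state n) (k : 'I_n) :
    gaussian_state 1 :=
  {| mean := reduced_mean (mean rho) k;
     cov := reduced_cov (cov rho) k;
     cov_sym := reduced_cov_sym k (cov_sym rho);
     cov_uncertainty := reduced_cov_uncertainty k (cov_uncertainty rho) |}.

End PhaseSpace.

(* Main.v *)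
(** Necessity. Write d_k = b_k + 1 and let g be the covariance matrix of a pure
    state, with 2x2 blocks g_jk. Purity gives g sigma g = sigma, and since
    X sigma1 X^T = det X sigma1 for 2x2 matrices, the j-th diagonal block of this
    identity reads sum_k det g_jk = 1, where det g_jj = d_j^2. The uncertainty
    relation on modes j and k, a Cauchy-Schwarz bound
    |<a_j a_k>|^2 <= <a_j a_j^*> <a_k^* a_k> for the annihilation operators, gives
    - det g_jk <= (d_j + 1) (d_k - 1). Summing over k <> j,
    d_j^2 - 1 <= (d_j + 1) sum_(k <> j) (d_k - 1).

    Sufficiency. Position and momentum are kept uncorrelated: if u_i, v_i are
    dual bases of R^n, then the matrix with blocks diag(u_i(j), v_i(j)) is a
    symplectic S, and the marginals of the pure state S S^T are diag(|u_k|^2, |v_k|^2).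
    Dual bases with |u_k|^2 = |v_k|^2 = d_k are built by induction on n: the last
    two modes are replaced by one mode c such that (b_1, ..., b_(n-2), c) and
    (b_(n-1), b_n, c) both satisfy the polygon inequalities, and that mode is then
    coupled to a vacuum mode by a 2x2 linear map. *)

Require Import Defs.
From mathcomp Require Import all_boot all_order all_algebra.
From mathcomp Require Import reals complex.
From mathcomp Require Import ring lra.

Set Implicit Arguments.
Unset Strict Implicit.
Unset Printing Implicit Defensive.

Import Order.TTheory GRing.Theory Num.Theory.
Local Open Scope ring_scope.
Local Open Scope sesquilinear_scope.

(** * Coupling a thermal mode to a vacuum mode *)

Section DualBases.
Variable R : rcfType.
Implicit Types d p q r s : R.

(** Solve [(m + k)^2 = K + 2 t] and [(m - k)^2 = K - 2 t]. With both roots taken nonnegative, [m]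
    vanishes only if both roots do. *)
Lemma ex_sum_sqr_prod (K t : R) : 2 * `|t| <= K ->
  exists m k, m ^+ 2 + k ^+ 2 = K /\ m * k = t /\ (m = 0 -> t = 0 /\ k = 0).
Proof.
move=> tK; have := ler_norm t; have := ler_norm (- t); rewrite normrN => h1 h2.
have hu : 0 <= K + 2 * t by lra.
have hv : 0 <= K - 2 * t by lra.
pose u := Num.sqrt (K + 2 * t); pose v := Num.sqrt (K - 2 * t).
have u2 : u ^+ 2 = K + 2 * t by rewrite sqr_sqrtr.
have v2 : v ^+ 2 = K - 2 * t by rewrite sqr_sqrtr.
exists ((u + v) / 2), ((u - v) / 2); split; first by field: u2 v2.
split; first by field: u2 v2.
have u0 : 0 <= u by rewrite sqrtr_ge0.
have v0 : 0 <= v by rewrite sqrtr_ge0.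
move=> uv; have ue : u = 0 by lra.
have ve : v = 0 by lra.
rewrite ue expr0n /= in u2; rewrite ve expr0n /= in v2.
by split; [lra | rewrite ue ve; lra].
Qed.

(* A unimodular matrix (p q; r s) is recovered from ps and qr together with pr and
   qs, whose product is also ps * qr; only (pr)^2 + (qs)^2 = K has to be arranged. *)
Lemma unimodular_of_products (a e K : R) : a - e = 1 -> a != 0 ->
  2 * `|a * e| <= K ->
  exists p q r s, [/\ p * s = a, q * r = e, p * s - q * r = 1 &
    (p * r) ^+ 2 + (q * s) ^+ 2 = K].
Proof.
move=> ae a0 /ex_sum_sqr_prod [m [k [mkK [mk m0]]]].
(* Here [m] stands for [pr] and [k] for [qs]. If [m = 0] then [e = 0], [a = 1] and [K = 0], and the
   identity matrix serves; otherwise normalize [p = 1]. *)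
have [mz|mnz] := eqVneq m 0.
  have [/eqP aez kz] := m0 mz; move: aez; rewrite mulf_eq0 (negPf a0) /= => /eqP ez.
  have a1 : a = 1 by lra.
  by exists 1, 0, m, a; split; rewrite -?mkK ?kz ?mz ?ez ?a1; ring.
exists 1, (e / m), m, a; split; [by ring | by field | | ].
  by rewrite -[RHS]ae; field.
by rewrite -mkK mul1r -mulrA [m^-1 * _]mulrC mulrA [e * a]mulrC -mk; field.
Qed.

(* The two products are the squared marginals of the modes obtained by applying
   the unimodular matrix (p q; r s) to positions, and its inverse transpose to
   momenta, of a thermal mode diag(d, d) and a vacuum mode. *)
Lemma two_mode_product_le (d d1 d2 : R) : 1 <= d -> 1 <= d2 -> d2 <= d1 ->
  d + 1 <= d1 + d2 -> d1 + 1 <= d + d2 ->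
  exists p q r s, [/\ p * s - q * r = 1,
    (d * p ^+ 2 + q ^+ 2) * (d * s ^+ 2 + r ^+ 2) = d1 ^+ 2 &
    (d * r ^+ 2 + s ^+ 2) * (d * q ^+ 2 + p ^+ 2) = d2 ^+ 2].
Proof.
move=> d_ge1 d2_ge1 d12 dle d1le.
(* For d = 1 the hypotheses force d1 = d2, and x / 0 = 0 gives a = 1 / 2. *)
pose a := (1 + (d1 ^+ 2 - d2 ^+ 2) / (d ^+ 2 - 1)) / 2.
pose e := a - 1.
have d0 : d != 0 by lra.
(* The difference of the two target equations is [(d^2 - 1) ((ps)^2 - (qr)^2) = d1^2 - d2^2]; with
   [ps - qr = 1] it dictates [ps = a] and [qr = e]. *)
have aE : (d ^+ 2 - 1) * (a + e) = d1 ^+ 2 - d2 ^+ 2.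
  have [dz|dnz] := eqVneq (d ^+ 2 - 1) 0; last by rewrite /e /a; field.
  have d_eq : d = 1 by apply: le_anti; rewrite d_ge1 andbT; nra.
  have : d1 = d2. move: dle d1le d12; by rewrite d_eq; lra.
  by move=> ->; rewrite dz; ring.
have a_ge : 1 / 2 <= a.
  have h1 : 0 <= d1 ^+ 2 - d2 ^+ 2 by rewrite subr_sqr mulr_ge0; lra.
  have h2 : 0 <= d ^+ 2 - 1 by rewrite subr_sqr_1 mulr_ge0; lra.
  have : 0 <= (d1 ^+ 2 - d2 ^+ 2) / (d ^+ 2 - 1) by rewrite divr_ge0.
  by rewrite /a; lra.
have a0 : a != 0 by lra.
have aE2 : (d ^+ 2 - 1) * a *+ 2 = d ^+ 2 - 1 + d1 ^+ 2 - d2 ^+ 2.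
  by rewrite -[_ - d2 ^+ 2]addrA -aE /e; ring.
(* Squared, this becomes [2 |a e| <= K] for the [K] chosen below. According to the sign of [e],
   multiplying by [d - 1] or [d + 1] reduces it to [(d1 - d + 1)^2 <= d2^2] or
   [(d1 - d - 1)^2 <= d2^2]. *)
have bound : d * a + `|e| <= d1.
  have [e0|e0] := leP 0 e.
    have d_gt1 : 0 < d - 1.
      rewrite subr_gt0 lt_neqAle d_ge1 andbT.
      apply: contraTneq e0 => d1E; rewrite /e /a -d1E expr1n subrr invr0 mulr0 addr0.
      by rewrite -ltNge; lra.
    have : 0 <= (d2 - (d1 - d + 1)) * (d2 + (d1 - d + 1)) by apply: mulr_ge0; lra.
    move=> h; rewrite ger0_norm // /e -(ler_pM2l d_gt1).
    have -> : (d - 1) * (d * a + (a - 1)) = (d ^+ 2 - 1) * a - (d - 1) by ring.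
    by lra.
  have dp1 : 0 < d + 1 by lra.
  have : 0 <= (d2 - (d1 - d - 1)) * (d2 + (d1 - d - 1)) by apply: mulr_ge0; lra.
  move=> h; rewrite ltr0_norm // /e -(ler_pM2l dp1).
  have -> : (d + 1) * (d * a + - (a - 1)) = (d ^+ 2 - 1) * a + (d + 1) by ring.
  by lra.
clearbody a.
have ae : a - e = 1 by rewrite /e; ring.
clearbody e.
(* The value of [(pr)^2 + (qs)^2] forced by the first target equation. *)
pose K := (d1 ^+ 2 - d ^+ 2 * a ^+ 2 - e ^+ 2) / d.
have KE : d * K = d1 ^+ 2 - d ^+ 2 * a ^+ 2 - e ^+ 2 by rewrite /K; field.
have hK : 2 * `|a * e| <= K.
  rewrite ler_pdivlMr; last by lra.
  rewrite normrM (ger0_norm (x := a)); last by lra.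
  have n0 := normr_ge0 e; have : `|e| ^+ 2 = e ^+ 2 by rewrite real_normK ?num_real.
  have : (d * a + `|e|) ^+ 2 <= d1 ^+ 2.
    by rewrite lerXn2r // nnegrE ?addr_ge0 ?mulr_ge0 //; lra.
  by lra.
have [p [q [r [s [ps qr det pq]]]]] := unimodular_of_products ae a0 hK.
exists p, q, r, s; split=> //.
  have -> : d1 ^+ 2 = d * K + d ^+ 2 * a ^+ 2 + e ^+ 2 by rewrite KE; ring.
  by rewrite -pq -ps -qr; ring.
have -> : d2 ^+ 2 = d * K + d ^+ 2 * e ^+ 2 + a ^+ 2.
  transitivity (d1 ^+ 2 - (d ^+ 2 - 1) * (a + e) * (a - e)).
    by rewrite aE ae; ring.
  by rewrite KE; ring.
by rewrite -pq -ps -qr; ring.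
Qed.

(** Exchanging the rows, with a sign to keep determinant 1, exchanges [d1] and [d2]. *)
Lemma two_mode_product (d d1 d2 : R) : 1 <= d -> 1 <= d1 -> 1 <= d2 ->
  d + 1 <= d1 + d2 -> d1 + 1 <= d + d2 -> d2 + 1 <= d + d1 ->
  exists p q r s, [/\ p * s - q * r = 1,
    (d * p ^+ 2 + q ^+ 2) * (d * s ^+ 2 + r ^+ 2) = d1 ^+ 2 &
    (d * r ^+ 2 + s ^+ 2) * (d * q ^+ 2 + p ^+ 2) = d2 ^+ 2].
Proof.
move=> hd hd1 hd2 h0 h1 h2; have [d21|d12] := leP d2 d1.
  exact: two_mode_product_le.
rewrite [d1 + d2]addrC in h0.
have [p [q [r [s [det e1 e2]]]]] := two_mode_product_le hd hd1 (ltW d12) h0 h2.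
exists (- r), (- s), p, q; split; first by rewrite -det; ring.
  by rewrite -e2; ring.
by rewrite -e1; ring.
Qed.

(** Local squeezing: rescaling position by [l] and momentum by [l^-1] equalizes the variances [x]
    and [y] of one mode. *)
Lemma balancing_factor (x y d : R) : 0 < d -> 0 <= x -> x * y = d ^+ 2 ->
  exists2 l, l != 0 & l ^+ 2 * x = d /\ l ^- 2 * y = d.
Proof.
move=> d0 x0 xy.
have xn : x != 0.
  by apply/eqP => xz; move/eqP: xy; rewrite xz mul0r eq_sym expf_eq0 /= gt_eqF.
have xp : 0 < x by rewrite lt_neqAle eq_sym xn.
have l2 : Num.sqrt (d / x) ^+ 2 = d / x by rewrite sqr_sqrtr // divr_ge0 // ltW.
exists (Num.sqrt (d / x)).
  by rewrite sqrtr_eq0 -ltNge divr_gt0.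
rewrite l2; split; first by field.
have -> : y = d ^+ 2 / x by rewrite -xy; field.
by field; rewrite xn gt_eqF.
Qed.


(** * Inner product of row vectors *)

Definition dot n (x y : 'rV[R]_n) : R := (x *m y^T) 0 0.

Lemma dotC n (x y : 'rV_n) : dot x y = dot y x.
Proof. by rewrite /dot -[in LHS](trmxK x) -trmx_mul mxE. Qed.

Lemma dotDl n (x y z : 'rV_n) : dot (x + y) z = dot x z + dot y z.
Proof. by rewrite /dot mulmxDl mxE. Qed.

Lemma dotZl n a (x y : 'rV_n) : dot (a *: x) y = a * dot x y.
Proof. by rewrite /dot -scalemxAl mxE. Qed.

Lemma dotDr n (x y z : 'rV_n) : dot z (x + y) = dot z x + dot z y.
Proof. by rewrite !(dotC z) dotDl. Qed.

Lemma dotZr n a (x y : 'rV_n) : dot x (a *: y) = a * dot x y.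
Proof. by rewrite !(dotC x) dotZl. Qed.

Lemma dot_row_mx m n (x z : 'rV_m) (y t : 'rV_n) :
  dot (row_mx x y) (row_mx z t) = dot x z + dot y t.
Proof. by rewrite /dot tr_row_mx mul_row_col mxE. Qed.

Lemma dot_scalar (x y : R) : dot (x%:M : 'rV_1) y%:M = x * y.
Proof. by rewrite /dot tr_scalar_mx -scalar_mxM mxE. Qed.

Lemma dot0l n (x : 'rV_n) : dot 0 x = 0.
Proof. by rewrite /dot mul0mx mxE. Qed.

Lemma dot0r n (x : 'rV_n) : dot x 0 = 0.
Proof. by rewrite dotC dot0l. Qed.

(** * Inductive construction of the dual bases *)

Lemma two_mode_split (d d1 d2 : R) : 1 <= d -> 1 <= d1 -> 1 <= d2 ->
  d + 1 <= d1 + d2 -> d1 + 1 <= d + d2 -> d2 + 1 <= d + d1 ->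
  exists p q r s p' q' r' s',
    [/\ p * p' + q * q' = 1, p * r' + q * s' = 0,
        r * p' + s * q' = 0 & r * r' + s * s' = 1] /\
    [/\ d * p ^+ 2 + q ^+ 2 = d1, d * p' ^+ 2 + q' ^+ 2 = d1,
        d * r ^+ 2 + s ^+ 2 = d2 & d * r' ^+ 2 + s' ^+ 2 = d2].
Proof.
move=> hd hd1 hd2 h0 h1 h2.
have [p [q [r [s [det e1 e2]]]]] := two_mode_product hd hd1 hd2 h0 h1 h2.
have nn (x y : R) : 0 <= d * x ^+ 2 + y ^+ 2.
  by rewrite addr_ge0 ?sqr_ge0 // mulr_ge0 ?sqr_ge0 // (le_trans ler01).
have [l l0 [l1 l1']] := balancing_factor (lt_le_trans ltr01 hd1) (nn p q) e1.
have [m m0 [m1 m1']] := balancing_factor (lt_le_trans ltr01 hd2) (nn r s) e2.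
(* The primed entries form the inverse transpose of the unprimed matrix, whose rows are squeezed by
   [l] and [m]. *)
exists (l * p), (l * q), (m * r), (m * s).
exists (l^-1 * s), (- l^-1 * r), (- m^-1 * q), (m^-1 * p).
have ps : p * s = 1 + q * r by rewrite -det; ring.
split; split.
- by transitivity (p * s - q * r); [field | ].
- by field.
- by field.
- by transitivity (p * s - q * r); [field | ].
- by rewrite -l1; ring.
- by rewrite -l1'; field.
- by rewrite -m1; ring.
- by rewrite -m1'; field.
Qed.

(** Indexing by [nat] lets the induction shorten the family without casts between ordinals. The
    polygon inequality has [b j] added to both sides, so that a single total sum occurs. *)
Lemma dual_bases n (b : nat -> R) :
  (forall j, (j < n.+1)%N -> 0 <= b j /\ b j *+ 2 <= \sum_(k < n.+1) b k) ->
  exists u v : nat -> 'rV[R]_n.+1,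
    (forall i j, (i < n.+1)%N -> (j < n.+1)%N -> dot (u i) (v j) = (i == j)%:R) /\
    (forall i, (i < n.+1)%N -> dot (u i) (u i) = b i + 1 /\ dot (v i) (v i) = b i + 1).
Proof.
elim: n b => [|n IHn] b hb.
  have [b0 b0'] := hb 0 isT; rewrite big_ord1 /= in b0'.
  have {b0 b0'} b0 : b 0 = 0 by apply: le_anti; rewrite b0 andbT; lra.
  have d1 : dot (1%:M : 'rV[R]_1) 1%:M = 1 by rewrite /dot trmx1 mulmx1 mxE.
  exists (fun=> 1%:M), (fun=> 1%:M); split; first by move=> [|//] [|//].
  by move=> [|//] _; rewrite b0 d1 add0r.
pose s := \sum_(k < n) b k.
(* The largest [c] allowed by the upper bounds [c <= b n + b n.+1] and [c <= s]; all other polygon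
   inequalities only ask [c] to be large. *)
pose c := Num.min (b n + b n.+1) s.
have sumE : \sum_(k < n.+2) b k = s + b n + b n.+1.
  by rewrite !big_ord_recr.
have b_ge0 j : (j < n.+2)%N -> 0 <= b j by case/hb.
have b_le j : (j < n.+2)%N -> b j *+ 2 <= s + b n + b n.+1.
  by rewrite -sumE; case/hb.
have bn := b_ge0 n (leqnSn _); have bn1 := b_ge0 n.+1 (leqnn _).
have bnl := b_le n (leqnSn _); have bn1l := b_le n.+1 (leqnn _).
have s0 : 0 <= s.
  by apply: sumr_ge0 => i _; apply: b_ge0; rewrite ltnS ltnW // ltnS ltnW.
have hc : [/\ 0 <= c, c <= s, c <= b n + b n.+1, b n <= c + b n.+1 & b n.+1 <= c + b n].
  by rewrite /c; case: (leP (b n + b n.+1) s) => h; split; lra.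
have c_ge j : (j < n)%N -> b j *+ 2 <= s + c.
  move=> jn; have jn2 : (j < n.+2)%N by rewrite ltnS ltnW // ltnS ltnW.
  have := b_le j jn2; have : b j <= s.
    rewrite /s (bigD1 (Ordinal jn)) //= lerDl; apply: sumr_ge0 => i _.
    by apply: b_ge0; rewrite ltnS ltnW // ltnS ltnW.
  by rewrite /c; case: (leP (b n + b n.+1) s) => h; lra.
case: hc => c0 cs c1 c2 c3.
pose b' k := if (k < n)%N then b k else c.
have s'E : \sum_(k < n.+1) b' k = s + c.
  rewrite big_ord_recr /= {2}/b' ltnn; congr (_ + _).
  by apply: eq_bigr => i _; rewrite /b' ltn_ord.
have [j jn|u [v [uv uu]]] := IHn b'.
  rewrite s'E /b'; case: ifP => jn'.
    by split; [apply: b_ge0; rewrite ltnW | exact: c_ge].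
  by split=> //; lra.
have [||||||p [q [r [t [p' [q' [r' [t' [[e1 e2 e3 e4] [f1 f2 f3 f4]]]]]]]]]] :=
  @two_mode_split (c + 1) (b n + 1) (b n.+1 + 1); try lra.
(* The new leading coordinate is the vacuum mode. Vectors below [n] are padded by 0; the vector
   [w n] of the merged mode is mixed with the new unit vector into the last two. *)
pose ext (w : nat -> 'rV[R]_n.+1) p q r t k : 'rV[R]_(1 + n.+1) :=
  if (k < n)%N then row_mx 0 (w k) else
  if k == n then row_mx q%:M (p *: w n) else row_mx t%:M (r *: w n).
have dot_ext (x z : 'rV_1) (y w : 'rV_n.+1) :
  @dot n.+2 (row_mx x y) (row_mx z w) = dot x z + dot y w.
  exact: (dot_row_mx x z y w).
have dotE := (dot_ext, dot0l, dot0r, dot_scalar, dotZl, dotZr).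
have last k : (k < n.+2)%N -> (k < n)%N = false -> k <> n -> k = n.+1.
  move=> k_le kn /eqP k_neq; apply/eqP.
  by rewrite eqn_leq -ltnS k_le ltn_neqAle eq_sym k_neq leqNgt kn.
have [un vn] := uu n (leqnn _); rewrite /b' ltnn in un vn.
have lt1 k : (k < n)%N -> (k < n.+1)%N := @leqW _ _.
have nn1 := ltnSn n.
have neF k : (k < n)%N -> (k == n) = false by move=> kn; exact: ltn_eqF.
exists (ext u p q r t), (ext v p' q' r' t'); split=> [i j ilt jlt | i ilt].
  rewrite /ext; case: (boolP (i < n)%N) => [il|/negPf il];
    case: (boolP (j < n)%N) => [jl|/negPf jl];
    try case: (i =P n) => [iE|/last -/(_ ilt il) iE];
    try case: (j =P n) => [jE|/last -/(_ jlt jl) jE];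
    rewrite !dotE ?add0r uv ?nn1 ?lt1 // ?iE ?jE ?eqxx ?mulr1.
  - by rewrite (neF _ il) mulr0.
  - by rewrite (neF _ il) (ltn_eqF (lt1 i il)) mulr0.
  - by rewrite eq_sym (neF _ jl) mulr0.
  - by rewrite eq_sym (neF _ jl) eq_sym (ltn_eqF (lt1 j jl)) mulr0.
  - by rewrite addrC.
  - by rewrite addrC e2 (ltn_eqF nn1).
  - by rewrite addrC e3 eq_sym (ltn_eqF nn1).
  - by rewrite addrC.
rewrite /ext; case: ifP => [il|il].
  by rewrite !dotE !add0r; have := uu i (lt1 i il); rewrite /b' il.
case: eqP => [->|/(last _ ilt il) ->]; rewrite !dotE un vn; split.
- by rewrite -f1; ring.
- by rewrite -f2; ring.
- by rewrite -f3; ring.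
- by rewrite -f4; ring.
Qed.

End DualBases.

(** * Matrices of size two *)

Lemma matrix2P (T : Type) (A B : 'M[T]_2) :
  A 0 0 = B 0 0 -> A 0 1 = B 0 1 -> A 1 0 = B 1 0 -> A 1 1 = B 1 1 -> A = B.
Proof.
move=> h1 h2 h3 h4; have ord2 (i : 'I_2) : i = 0 \/ i = 1.
  by case: i => [[|[|//]] hi]; [left | right]; exact: val_inj.
by apply/matrixP => i j; case: (ord2 i) => ->; case: (ord2 j) => ->.
Qed.

Lemma mulmx2E (A : pzSemiRingType) m p (X : 'M[A]_(m, 2)) (Y : 'M_(2, p)) i j :
  (X *m Y) i j = X i 0 * Y 0 j + X i 1 * Y 1 j.
Proof.
rewrite mxE !big_ord_recl big_ord0 addr0.
by rewrite (_ : lift ord0 ord0 = 1) //; exact: val_inj.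
Qed.

Lemma det_mx22 (A : comPzRingType) (X : 'M[A]_2) :
  \det X = X 0 0 * X 1 1 - X 0 1 * X 1 0.
Proof.
rewrite (expand_det_row _ 0) !big_ord_recl big_ord0 addr0 /cofactor !det_mx11 !mxE /=.
rewrite expr0 expr1 mul1r mulN1r mulrN.
by congr (_ * X _ _ - X _ _ * X _ _); apply: val_inj.
Qed.

(** * Symplectic matrices and pure covariance matrices *)

Section SymplecticGroup.
Variable R : realType.
Implicit Types n : nat.

Lemma sigma1E :
  [/\ sigma1 R 0 0 = 0, sigma1 R 0 1 = 1, sigma1 R 1 0 = -1 & sigma1 R 1 1 = 0].
Proof. by split; rewrite mxE /=; ring. Qed.

Lemma sigma1_congr (X : 'M[R]_2) : X *m sigma1 R *m X^T = \det X *: sigma1 R.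
Proof. by apply: matrix2P; rewrite !mulmx2E det_mx22 !mxE /=; ring. Qed.

Lemma sigma1_sqr : sigma1 R *m sigma1 R = - 1%:M.
Proof. by apply: matrix2P; rewrite !mulmx2E !mxE /=; ring. Qed.

Lemma sigma1_tr : (sigma1 R)^T = - sigma1 R.
Proof. by apply/matrixP => i j; rewrite !mxE opprB. Qed.

Lemma sigma_tr n : (sigma R n)^T = - sigma R n.
Proof.
by rewrite /sigma tr_mxdiag -mxdiagN; apply: eq_mxdiag => i; rewrite sigma1_tr.
Qed.

Lemma submxblock_sigma n (j k : 'I_n) :
  submxblock (sigma R n) j k = if j == k then sigma1 R else 0.
Proof.
by rewrite mxblockK; case: eqP => // _; rewrite conform_mx_id.
Qed.

Lemma sigma_sqr n : sigma R n *m sigma R n = - 1%:M.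
Proof.
rewrite -mxdiagZ -mxdiagN {1 2}/sigma {2}/mxdiag mul_mxdiag_mxblock.
apply: eq_mxblock => i j; case: eqP => _; last by rewrite mulmx0.
by rewrite !conform_mx_id sigma1_sqr.
Qed.

(** Since [sigma] squares to -1, [- sigma S^T sigma] is a right inverse of [S], hence also a left
    one. *)
Lemma symplectic_tr n (S : 'M[R]_(phase_dim n)) :
  symplectic S -> S^T *m sigma R n *m S = sigma R n.
Proof.
move=> symS; have : S *m (- (sigma R n *m S^T *m sigma R n)) = 1%:M.
  by rewrite mulmxN !mulmxA symS sigma_sqr opprK.
move/mulmx1C/(congr1 (mulmx (sigma R n))).
by rewrite mulmx1 mulNmx mulmxN !mulmxA sigma_sqr !mulNmx mul1mx opprK.
Qed.

Lemma symplectic_inv n (S : 'M[R]_(phase_dim n)) : symplectic S ->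
  exists V, [/\ symplectic V, S *m V = 1%:M & V *m S = 1%:M].
Proof.
move=> symS; have SV : S *m (- (sigma R n *m S^T *m sigma R n)) = 1%:M.
  by rewrite mulmxN !mulmxA symS sigma_sqr opprK.
set V := - _ in SV; have VS := mulmx1C SV.
exists V; split=> //; rewrite /symplectic -{1}symS !mulmxA VS mul1mx.
by rewrite -mulmxA -trmx_mul VS trmx1 mulmx1.
Qed.

(** Inverting the diagonalization gives [g = V V^T] with [V] symplectic; then [V^T sigma V]
    collapses to [sigma]. *)
Lemma pure_cov_symplectic n (g : 'M[R]_(phase_dim n)) :
  symplectic_spectrum g (fun=> 1) -> g *m sigma R n *m g = sigma R n.
Proof.
case=> S [symS]; rewrite mxdiagZ => Sg.
have [V [symV SV VS]] := symplectic_inv symS.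
have gE : g = V *m V^T.
  have := congr1 (fun A => V *m A *m V^T) Sg.
  by rewrite mulmx1 !mulmxA VS mul1mx -!mulmxA -trmx_mul VS trmx1 mulmx1.
rewrite {1}gE -mulmxA {1}gE !mulmxA -(mulmxA V V^T) -(mulmxA V _ V).
by rewrite symplectic_tr.
Qed.

Lemma pure_cov_det n (g : 'M[R]_(phase_dim n)) j : g^T = g ->
  g *m sigma R n *m g = sigma R n -> \sum_k \det (submxblock g j k) = 1.
Proof.
move=> gT; rewrite -{1 2}[g]submxblockK mul_mxblock_mxdiag mul_mxblock.
move/(congr1 (fun A => submxblock A j j)); rewrite mxblockK submxblock_sigma eqxx.
(* By symmetry block [(k, j)] is the transpose of block [(j, k)], so every summand is a congruence
   of [sigma1]. *)
under eq_bigr => k _ do rewrite -{2}gT -tr_submxblock sigma1_congr.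
rewrite -scaler_suml; case: sigma1E => _ s01 _ _ /matrixP/(_ 0 1).
by rewrite mxE s01 mulr1.
Qed.

(** * The uncertainty relation in real form *)

Definition form m (A : 'M[R]_m) (x y : 'cV_m) : R := (x^T *m A *m y) 0 0.

Lemma formDl m (A : 'M_m) x y z : form A (x + y) z = form A x z + form A y z.
Proof. by rewrite /form linearD !mulmxDl mxE. Qed.

Lemma formDr m (A : 'M_m) x y z : form A z (x + y) = form A z x + form A z y.
Proof. by rewrite /form mulmxDr mxE. Qed.

Lemma form_tr m (A : 'M_m) x y : form A^T x y = form A y x.
Proof. by rewrite /form -[in RHS]mulmxA -[in LHS](trmxK y) -!trmx_mul mxE. Qed.

Lemma form_mul m p (A : 'M_m) (F G : 'M_(m, p)) x y :
  form A (F *m x) (G *m y) = form (F^T *m A *m G) x y.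
Proof. by rewrite /form trmx_mul !mulmxA. Qed.

Lemma form_oppl m (A : 'M_m) x y : form (- A) x y = - form A x y.
Proof. by rewrite /form mulmxN mulNmx mxE. Qed.

Lemma cplx_adj m p (A : 'M[R]_(m, p)) : (cplx A) ^t* = cplx A^T.
Proof.
apply/matrixP => i j; rewrite !mxE; apply: conj_Creal.
by rewrite complex_real.
Qed.

Lemma cplx_mul m p q (A B : 'M[R]_(m, p)) (C D : 'M[R]_(p, q)) :
  (cplx A + 'i *: cplx B) *m (cplx C + 'i *: cplx D) =
  cplx (A *m C - B *m D) + 'i *: cplx (A *m D + B *m C).
Proof.
rewrite mulmxDl !mulmxDr -!scalemxAl -!scalemxAr scalerA -expr2 sqrCi scaleN1r.
rewrite /cplx map_mxB map_mxD !map_mxM scalerDr -!addrA; congr (_ + _).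
by rewrite [RHS]addrC -!addrA.
Qed.

(** This is the real part of the positivity condition at the complex vector [x + i y]. *)
Lemma uncertainty_real n (g : 'M[R]_(phase_dim n)) x y : uncertainty g ->
  form (sigma R n) x y *+ 2 <= form g x x + form g y y.
Proof.
have sT := sigma_tr n; set s := sigma R n in sT *.
have syx : form s y x = - form s x y by rewrite -form_tr sT form_oppl.
move=> /(_ (cplx x + 'i *: cplx y)); rewrite -/s.
have -> : (cplx x + 'i *: cplx y) ^t* = cplx x^T + 'i *: cplx (- y^T).
  rewrite linearD linearZ map_mxD map_mxZ !cplx_adj /=.
  by rewrite [Num.conj _]conjCi scaleNr /cplx map_mxN scalerN.
rewrite !cplx_mul; set P := (X in cplx X + _); set Q := (X in _ + _ *: cplx X).
have -> : (cplx P + 'i *: cplx Q) 0 0 = Complex (P 0 0) (Q 0 0).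
  rewrite [RHS]complexE complexiE /= 2!mxE.
  by congr (_ + _); rewrite ?mxE //; congr (_ * _); rewrite mxE.
rewrite lecE => /andP[_ /=].
have -> : P 0 0 = form g x x + form g y y - form s x y + form s y x.
  rewrite /P /form !(mulmxBl, mulmxDl, mulNmx).
  move: (x^T *m g *m x) (y^T *m g *m y) (x^T *m s *m y) (y^T *m s *m x) => A B C D.
  by rewrite !mxE; ring.
by rewrite syx; lra.
Qed.

(** The matrix [A = 1 + i sigma] is Hermitian with [A^2 = 2 A], so [S A S^T] is half the Gram matrix
    of [A S^T]. *)
Lemma uncertainty_gram n (S : 'M[R]_(phase_dim n)) :
  symplectic S -> uncertainty (S *m S^T).
Proof.
move=> symS v; set s := sigma R n.
have sE : S *m s *m S^T = s := symS.
pose A : 'M[R[i]]_(phase_dim n) := 1%:M + 'i *: cplx s.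
have -> : cplx (S *m S^T) + 'i *: cplx s = cplx S *m A *m cplx S^T.
  rewrite -{1}sE /A mulmxDr mulmx1 mulmxDl -scalemxAr -scalemxAl.
  by rewrite /cplx -!map_mxM.
have AT : A ^t* = A.
  rewrite /A linearD linearZ /= trmx1 map_mxD map_mxZ map_mx1 cplx_adj /=.
  by rewrite [Num.conj _]conjCi sigma_tr /cplx map_mxN scalerN scaleNr opprK.
have AA : A = 2^-1 *: (A *m A).
  have -> : A *m A = A *+ 2.
    rewrite {1}/A mulmxDl mul1mx {2}/A mulmxDr mulmx1 -scalemxAl -scalemxAr scalerA.
    rewrite -expr2 sqrCi scaleN1r /cplx -map_mxM sigma_sqr map_mxN map_mx1 opprK.
    by rewrite mulr2n [X in _ + X = _]addrC.
  by rewrite -[A *+ 2]scaler_nat scalerA mulVf ?scale1r // pnatr_eq0.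
pose w := A *m cplx S^T *m v.
have -> : v ^t* *m (cplx S *m A *m cplx S^T) *m v = 2^-1 *: (w ^t* *m w).
  have -> : w ^t* = v ^t* *m cplx S *m A.
    by rewrite /w !trmx_mul !map_mxM AT cplx_adj trmxK mulmxA.
  by rewrite {1}AA -scalemxAr -scalemxAl -scalemxAr -scalemxAl /w !mulmxA.
rewrite mxE mulr_ge0 ?invr_ge0 ?ler0n // mxE sumr_ge0 // => i _.
by rewrite !mxE mulrC mul_conjC_ge0.
Qed.

Lemma form0 m x y : form (0 : 'M_m) x y = 0.
Proof. by rewrite /form mulmx0 mul0mx mxE. Qed.

Definition vec2 (a b : R) : 'cV_2 := \col_(i < 2) (if i == 0 then a else b).

Lemma form_vec2 (A : 'M_2) a b c d : form A (vec2 a b) (vec2 c d) =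
  a * c * A 0 0 + a * d * A 0 1 + b * c * A 1 0 + b * d * A 1 1.
Proof. by rewrite /form !mulmx2E !mxE /=; ring. Qed.

Lemma scalar2E (a : R) :
  [/\ (a%:M : 'M_2) 0 0 = a, (a%:M : 'M_2) 0 1 = 0,
      (a%:M : 'M_2) 1 0 = 0 & (a%:M : 'M_2) 1 1 = a].
Proof. by split; rewrite mxE. Qed.

(** On the canonical pair formed by the columns of [F], the uncertainty relation reads
    [2 <= 2 d]. *)
Lemma mode_bound n (g : 'M[R]_(phase_dim n)) (F : 'M_(phase_dim n, 2)) (d : R) :
  uncertainty g -> F^T *m g *m F = d%:M -> F^T *m sigma R n *m F = sigma1 R ->
  1 <= d.
Proof.
move=> ug Fg Fs.
have := uncertainty_real (F *m vec2 1 0) (F *m vec2 0 1) ug.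
rewrite !form_mul Fg Fs !form_vec2.
case: (scalar2E d) => -> -> -> ->; case: sigma1E => -> -> -> ->; lra.
Qed.

Lemma two_mode_bound n (g : 'M[R]_(phase_dim n)) (F G : 'M_(phase_dim n, 2)) (a d : R) :
  uncertainty g -> g^T = g ->
  F^T *m g *m F = a%:M -> G^T *m g *m G = d%:M ->
  F^T *m sigma R n *m F = sigma1 R -> G^T *m sigma R n *m G = sigma1 R ->
  F^T *m sigma R n *m G = 0 ->
  - \det (F^T *m g *m G) <= (a + 1) * (d - 1).
Proof.
move=> ug gT gF gG sF sG sFG.
have a1 := mode_bound ug gF sF; have d1 := mode_bound ug gG sG.
have sGF : G^T *m sigma R n *m F = 0.
  apply: trmx_inj; rewrite !trmx_mul trmxK sigma_tr mulNmx mulmxN mulmxA sFG.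
  by rewrite oppr0 trmx0.
have gGF : G^T *m g *m F = (F^T *m g *m G)^T by rewrite !trmx_mul trmxK gT mulmxA.
set Y := F^T *m g *m G in gGF *.
pose al := Y 0 0 - Y 1 1; pose be := Y 0 1 + Y 1 0.
have key (s t1 t2 : R) :
    0 <= (a + 1) * s ^+ 2 + (d - 1) * (t1 ^+ 2 + t2 ^+ 2) + s * (al * t1 + be * t2).
  (* The second vector is the first one turned by a right angle, in opposite senses in the two
     modes; this yields [a + 1] for one and [d - 1] for the other. *)
  have := uncertainty_real (F *m vec2 s 0 + G *m vec2 t1 t2)
    (F *m vec2 0 (- s) + G *m vec2 (- t2) t1) ug.
  rewrite !(formDl, formDr) !form_mul gF gG sF sG sFG sGF gGF.
  rewrite !form_tr -/Y !form0 !form_vec2.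
  case: (scalar2E a) => -> -> -> ->; case: (scalar2E d) => -> -> -> ->.
  by case: sigma1E => -> -> -> ->; rewrite /al /be; lra.
move: {ug gT gF gG sF sG sFG sGF gGF} Y @al @be key => Y al be key.
pose T := al ^+ 2 + be ^+ 2.
have T_le : T <= 4 * ((a + 1) * (d - 1)).
  have T0 : 0 <= T by rewrite addr_ge0 ?sqr_ge0.
  (* For [t] equal to [-2 (a + 1)] times [(al, be)], the expression in [key] is minimal at
     [s = T]. *)
  have := key T (- (2 * (a + 1)) * al) (- (2 * (a + 1)) * be).
  have -> : (a + 1) * T ^+ 2 +
      (d - 1) * ((- (2 * (a + 1)) * al) ^+ 2 + (- (2 * (a + 1)) * be) ^+ 2) +
      T * (al * (- (2 * (a + 1)) * al) + be * (- (2 * (a + 1)) * be)) =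
      ((a + 1) * T) * (4 * ((a + 1) * (d - 1)) - T) by rewrite /T; ring.
  move: T0; rewrite le_eqVlt => /orP[/eqP <- _|T0].
    by rewrite mulr_ge0 // mulr_ge0; lra.
  by rewrite pmulr_rge0 ?subr_ge0 // mulr_gt0; lra.
(* This sum of squares equals [T + 4 det Y]. *)
have : 0 <= (Y 0 0 + Y 1 1) ^+ 2 + (Y 0 1 - Y 1 0) ^+ 2 by rewrite addr_ge0 ?sqr_ge0.
by rewrite det_mx22; move: T_le; rewrite /T /al /be; lra.
Qed.

End SymplecticGroup.

(** * Necessity of the polygon inequalities *)

Section Marginals.
Variable R : realType.

Definition mode_embedding n (j : 'I_n) : 'M[R]_(phase_dim n, 2) :=
  \mxcol_(i < n) ((if i == j then 1%:M else 0) : 'M[R]_2).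

Lemma mode_embeddingE n (A : 'M[R]_(phase_dim n)) j k :
  (mode_embedding j)^T *m A *m mode_embedding k = submxblock A j k.
Proof.
rewrite /mode_embedding tr_mxcol -{1}[A]submxblockK mul_mxrow_mxblock mul_mxrow_mxcol.
rewrite (bigD1 k) //= eqxx mulmx1 [X in _ + X]big1 => [|i /negPf ->];
  last by rewrite mulmx0.
rewrite addr0 (bigD1 j) //= eqxx trmx1 mul1mx big1 ?addr0 // => i /negPf ->.
by rewrite trmx0 mul0mx.
Qed.

Lemma mode_embedding_mulE n (g : 'M[R]_(phase_dim n)) j k (A B : 'M_2) :
  (mode_embedding j *m A^T)^T *m g *m (mode_embedding k *m B^T) =
  A *m submxblock g j k *m B^T.
Proof. by rewrite trmx_mul trmxK -mode_embeddingE !mulmxA. Qed.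

Lemma single_mode_spectrum (h : 'M[R]_2) d :
  symplectic_spectrum (\mxblock_(i < 1, j < 1) h) (fun=> d) ->
  exists T : 'M[R]_2, T *m sigma1 R *m T^T = sigma1 R /\ T *m h *m T^T = d%:M.
Proof.
case=> S []; rewrite /symplectic -[S]submxblockK /sigma.
rewrite mul_mxblock_mxdiag tr_mxblock !mul_mxblock.
move=> /(congr1 (fun A => submxblock A 0 0)) + /(congr1 (fun A => submxblock A 0 0)).
rewrite !submxblock_diag !mxblockK !big_ord1 => sS dS.
by exists (submxblock S 0 0).
Qed.

Lemma polygon_of_pure n (rho : gaussian_state R n) (b : 'I_n -> R) :
  pure rho -> (forall k, sspec (reduced_state rho k) (fun=> b k + 1)) ->
  forall j, 0 <= b j /\ b j <= \sum_(k < n | k != j) b k.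
Proof.
move=> /pure_cov_symplectic gs hb j.
have gT := cov_sym rho; have ug := cov_uncertainty rho.
have {}hb k : exists T : 'M[R]_2, T *m sigma1 R *m T^T = sigma1 R /\
    T *m submxblock (cov rho) k k *m T^T = (b k + 1)%:M.
  exact: single_mode_spectrum (hb k).
move: (cov rho) gT ug gs hb => g gT ug gs hb.
have det1 (T : 'M[R]_2) : T *m sigma1 R *m T^T = sigma1 R -> \det T = 1.
  rewrite sigma1_congr; case: (sigma1E R) => _ s01 _ _ /matrixP/(_ 0 1).
  by rewrite mxE s01 mulr1.
have b_ge0 k : 0 <= b k.
  have [T [Ts Tg]] := hb k.
  suff: 1 <= b k + 1 by rewrite lerDr.
  apply: (mode_bound (F := mode_embedding k *m T^T) ug); rewrite mode_embedding_mulE //.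
  by rewrite submxblock_sigma eqxx.
split; first exact: b_ge0.
have [T [Ts Tg]] := hb j.
have det_jj : \det (submxblock g j j) = (b j + 1) ^+ 2.
  have := congr1 determinant Tg.
  by rewrite det_scalar !det_mulmx det_tr (det1 _ Ts) mul1r mulr1.
(* The local symplectic matrices [T] and [V] make both marginals scalar, as [two_mode_bound]
   requires; having determinant 1, they preserve the determinant of the off-diagonal block. *)
have det_jk k : k != j -> - \det (submxblock g j k) <= (b j + 1 + 1) * b k.
  move=> kj; have [V [Vs Vg]] := hb k.
  have -> : \det (submxblock g j k) =
      \det ((mode_embedding j *m T^T)^T *m g *m (mode_embedding k *m V^T)).
    rewrite mode_embedding_mulE !det_mulmx det_tr (det1 _ Ts) (det1 _ Vs).
    by rewrite mul1r mulr1.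
  rewrite -[X in _ * X](addrK 1).
  apply: two_mode_bound ug gT _ _ _ _ _;
    rewrite mode_embedding_mulE // submxblock_sigma ?eqxx //.
  by rewrite eq_sym (negPf kj) mulmx0 mul0mx.
have := pure_cov_det j gT gs; rewrite (bigD1 j) //= det_jj => det_sum.
have : \sum_(k < n | k != j) - \det (submxblock g j k) <=
    \sum_(k < n | k != j) (b j + 1 + 1) * b k by apply: ler_sum.
rewrite sumrN -mulr_sumr => sum_le; have bj := b_ge0 j.
(* The common factor cancels because [(b j + 1)^2 - 1 = (b j + 2) b j]. *)
rewrite -(ler_pM2l (x := b j + 1 + 1)); last by rewrite addr_gt0 // ltr_wpDl.
suff <- : - \sum_(k < n | k != j) \det (submxblock g j k) = (b j + 1 + 1) * b j by [].
by apply: (addrI (- (b j + 1) ^+ 2)); rewrite -opprD det_sum; ring.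
Qed.

(** * Sufficiency: pure states from dual bases *)

Definition diag2 (a b : R) : 'M[R]_2 :=
  \matrix_(i < 2, j < 2) (if i == j then if i == 0 then a else b else 0).

Lemma diag2_scalar a : diag2 a a = a%:M.
Proof. by apply: matrix2P; rewrite !mxE. Qed.

Lemma diag2_sum (I : finType) (f g : I -> R) :
  \sum_i diag2 (f i) (g i) = diag2 (\sum_i f i) (\sum_i g i).
Proof.
by apply: matrix2P; rewrite summxE mxE /=; [|rewrite big1 //..|];
  [apply: eq_bigr | | | apply: eq_bigr] => i _; rewrite mxE.
Qed.

Lemma diag2_mul a b c d : diag2 a b *m (diag2 c d)^T = diag2 (a * c) (b * d).
Proof. by apply: matrix2P; rewrite mulmx2E !mxE /=; ring. Qed.

Lemma diag2_sigma1 a b c d :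
  diag2 a b *m sigma1 R *m (diag2 c d)^T = diag2 (a * d) (b * c) *m sigma1 R.
Proof. by apply: matrix2P; rewrite !mulmx2E !mxE /=; ring. Qed.

Lemma pure_of_dual_bases n (u v : 'I_n -> 'rV[R]_n) (b : 'I_n -> R) :
  (forall i j, dot (u i) (v j) = (i == j)%:R) ->
  (forall i, dot (u i) (u i) = b i + 1) ->
  (forall i, dot (v i) (v i) = b i + 1) ->
  exists rho : gaussian_state R n,
    pure rho /\ forall k, sspec (reduced_state rho k) (fun=> b k + 1).
Proof.
move=> uv uu vv.
have vu i j : dot (v i) (u j) = (i == j)%:R by rewrite dotC uv eq_sym.
pose blk i j := diag2 (u i 0 j) (v i 0 j).
pose S : 'M[R]_(phase_dim n) := \mxblock_(i, j) blk i j.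
have dotE (x y : 'rV[R]_n) : dot x y = \sum_k x 0 k * y 0 k.
  by rewrite /dot mxE; apply: eq_bigr => k _; rewrite mxE.
have symS : symplectic S.
  rewrite /symplectic /S /sigma mul_mxblock_mxdiag tr_mxblock mul_mxblock.
  apply/mxblockP => i j; rewrite mxblockK submxblock_sigma.
  under eq_bigr do rewrite diag2_sigma1.
  rewrite -mulmx_suml diag2_sum -!dotE uv vu diag2_scalar mul_scalar_mx.
  by case: eqP; rewrite ?scale1r ?scale0r.
have gkk k : submxblock (S *m S^T) k k = (b k + 1)%:M.
  rewrite /S tr_mxblock mul_mxblock mxblockK.
  under eq_bigr do rewrite diag2_mul.
  by rewrite diag2_sum -!dotE uu vv diag2_scalar.
have gT : (S *m S^T)^T = S *m S^T by rewrite trmx_mul trmxK.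
exists (GaussianState 0 gT (uncertainty_gram symS)); split=> [|k].
  have [V [symV SV VS]] := symplectic_inv symS.
  exists V; split=> //=; rewrite mxdiagZ !mulmxA VS mul1mx.
  by rewrite -trmx_mul VS trmx1.
(* The marginals are already scalar, so the identity diagonalizes them. *)
exists 1%:M; split; first by rewrite /symplectic mul1mx trmx1 mulmx1.
rewrite mul1mx trmx1 mulmx1 /= /reduced_cov gkk.
by apply: eq_mxblock => i j; rewrite !ord1 eqxx conform_mx_id.
Qed.
End Marginals.

Theorem corollary2 (R : realType) (n : nat) (n_ge1 : (1 <= n)%N) (b : 'I_n -> R) :
  (exists rho : gaussian_state R n,
      pure rho /\ forall k : 'I_n, sspec (reduced_state rho k) (fun=> b k + 1))
  <->
  (forall j : 'I_n, 0 <= b j /\ b j <= \sum_(k < n | k != j) b k).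
Proof.
split=> [[rho [pure_rho hb]] | hb]; first exact: polygon_of_pure hb.
case: n n_ge1 b hb => // n _ b hb.
(* [inord] extends [b] to all naturals; only the values at indices up to [n] matter. *)
pose b' k := b (inord k).
have [j jn|u [v [uv uu]]] := @dual_bases R n b'.
  have [b0 bj] := hb (inord j); split=> //.
  under eq_bigr => k _ do rewrite /b' inord_val.
  by rewrite (bigD1 (inord j)) //= mulr2n lerD2l.
apply: (@pure_of_dual_bases _ _ u v b) => [i j|i|i].
- by rewrite uv.
- by rewrite (uu i _).1 // /b' inord_val.
- by rewrite (uu i _).2 // /b' inord_val.
Qed.
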